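(* Fix a positive integer $d$. Consider the scalar discrete-time linear regression equations $\mathcal{Y}_i(k+1)=\Delta(k)\theta_i$, $i\in\{1,\dots,q\}$, and the gradient parameter update $$\hat\theta_i(k+1)=\hat\theta_i(k)+\frac{\Delta(k)}{c_i+\Delta^2(k)}\left[\mathcal{Y}_i(k+1)-\Delta(k)\hat\theta_i(k)\right],$$ with positive constants $c_i$, together with the dynamic extension $$w_i(k+1)=\frac{c_i}{c_i+\Delta^2(k)}\,w_i(k),\quad w_i(0)=1,$$ and the sequence $$w_i^d(k)=\frac{w_i(k)}{w_i(k-d-1)}.$$ Then, $$\left[1-w_i^d(k)\right]\theta_i=\hat\theta_i(k)-w_i^d(k)\,\hat\theta_i(k-d).$$
   Context: Here $q$ is a positive integer, $\theta=(\theta_1,\dots,\theta_q)\in\mathbb{R}^q$ is a vector of unknown constant parameters, and $\mathcal{Y}_i$ and $\Delta$ are known scalar real-valued sequences indexed by non-negative integers $k$, obtained from a $q$-dimensional linear regression $y=\phi^\top\theta$, with $y$ and $\phi$ measurable, by the dynamic regressor extension and mixing (DREM) procedure; $\Delta$ is the determinant of an extended regressor matrix. $\hat\theta_i(k)$ is the estimate of $\theta_i$ at step $k$. The superscript $d$ in $w_i^d$ is a label recalling the integer $d$, not an exponent.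
   Formalization: The sequence is taken as w_i^d(k) = w_i(k)/w_i(k-d) instead of w_i(k)/w_i(k-d-1), for all k ≥ d, since the printed identity fails, e.g. for q=d=1, c=1, Δ≡1, θ=1, initial estimate 0, k=2 (3/4 versus 5/8). *)

(* Defs.v *)
From mathcomp Require Import all_boot all_order all_algebra reals.

Set Implicit Arguments.
Unset Strict Implicit.
Unset Printing Implicit Defensive.

Import Order.TTheory GRing.Theory Num.Theory.
Local Open Scope ring_scope.

(* The delay is d, i.e. w(k) / w(k-d), so that the ratio is the product of
   c / (c + Delta(j)^2) over k-d <= j < k, the window separating the estimates
   at k-d and k. A delay d+1 in the denominator would make the window one step
   too long and the identity relating those two estimates false in general.
   The subtraction is truncated: only indices with d <= k are meaningful. *)
Definition delay_ratio (R : realType) (w : nat -> R) (d k : nat) : R :=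
  w k / w (k - d)%N.

(* Main.v *)
(* The estimation error e = theta - theta_hat obeys the same scalar recursion
   as w, namely e(k+1) = c / (c + Delta(k)^2) e(k), so e(k) = w(k) e(0). As w
   never vanishes, e(k) = w(k) / w(k-d) e(k-d). *)
Require Import Defs.
From mathcomp Require Import all_boot all_order all_algebra reals.
From mathcomp Require Import ring.

Set Implicit Arguments.
Unset Strict Implicit.
Unset Printing Implicit Defensive.

Import Order.TTheory GRing.Theory Num.Theory.
Local Open Scope ring_scope.

(** Substituting [Y k.+1 = Delta k * theta] turns the innovation into [Delta k] times the error, so
    one update scales the error by [1 - Delta k ^+ 2 / (c + Delta k ^+ 2)], which is the factor
    driving [w]. *)
Lemma estimation_error_eq (F : realFieldType) (theta c : F)
    (Delta Y theta_hat w : nat -> F) :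
  0 < c -> (forall k, Y k.+1 = Delta k * theta) ->
  (forall k, theta_hat k.+1 = theta_hat k
     + Delta k / (c + Delta k ^+ 2) * (Y k.+1 - Delta k * theta_hat k)) ->
  w 0%N = 1 -> (forall k, w k.+1 = c / (c + Delta k ^+ 2) * w k) ->
  forall k, theta - theta_hat k = w k * (theta - theta_hat 0%N).
Proof.
move=> c_gt0 YE theta_hatE w0 wE; elim=> [|k IHk]; first by rewrite w0 mul1r.
have den_neq0 : c + Delta k ^+ 2 != 0.
  by rewrite gt_eqF // ltr_wpDr ?sqr_ge0.
by rewrite wE -mulrA -IHk theta_hatE YE; field.
Qed.

(** Makes the quotient in [delay_ratio] a genuine one, even where [Delta] vanishes. *)
Lemma gain_product_gt0 (F : realFieldType) (c : F) (Delta w : nat -> F) :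
  0 < c -> w 0%N = 1 -> (forall k, w k.+1 = c / (c + Delta k ^+ 2) * w k) ->
  forall k, 0 < w k.
Proof.
move=> c_gt0 w0 wE; elim=> [|k IHk]; first by rewrite w0 ltr01.
by rewrite wE mulr_gt0 // divr_gt0 // ltr_wpDr ?sqr_ge0.
Qed.

Theorem proposition4 (R : realType) (q : nat) (hq : (0 < q)%N)
  (d : nat) (hd : (0 < d)%N)
  (theta : 'cV[R]_q) (Delta : nat -> R) (Y : 'I_q -> nat -> R)
  (hY : forall (i : 'I_q) (k : nat), Y i k.+1 = Delta k * theta i 0)
  (c : 'I_q -> R) (hc : forall i : 'I_q, 0 < c i)
  (theta_hat : 'I_q -> nat -> R)
  (htheta_hat : forall (i : 'I_q) (k : nat),
     theta_hat i k.+1 =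
       theta_hat i k
       + Delta k / (c i + Delta k ^+ 2) * (Y i k.+1 - Delta k * theta_hat i k))
  (w : 'I_q -> nat -> R)
  (hw0 : forall i : 'I_q, w i 0%N = 1)
  (hw : forall (i : 'I_q) (k : nat),
     w i k.+1 = c i / (c i + Delta k ^+ 2) * w i k) :
  forall (i : 'I_q) (k : nat), (d <= k)%N ->
    (1 - delay_ratio (w i) d k) * theta i 0
    = theta_hat i k - delay_ratio (w i) d k * theta_hat i (k - d)%N.
Proof.
move=> i k _; rewrite /delay_ratio.
have error := estimation_error_eq (hc i) (hY i) (htheta_hat i) (hw0 i) (hw i).
have w_neq0 : w i (k - d)%N != 0.
  by rewrite gt_eqF // (gain_product_gt0 (hc i) (hw0 i) (hw i)).
(* Both errors are multiples of the same unknown initial error, which the quotient eliminates. *)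
have error_delay : theta i 0 - theta_hat i k
    = w i k / w i (k - d)%N * (theta i 0 - theta_hat i (k - d)%N).
  by rewrite (error k) (error (k - d)%N) mulrA divfK.
(* Writing [theta_hat i k] as [theta i 0] minus its error lets [error_delay] apply; the delayed
   estimate then cancels. *)
by rewrite mulrBl mul1r -[theta_hat i k](subKr (theta i 0)) error_delay; ring.
Qed.
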